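(* Let $([\underline{A};\overline{A}],O,B,U)$ be a PCS and let $L\in\mathbb{R}_{\ge0}^{k\times n}$ be a constrained proper positive lumping of it. Write $L=CD$ with $C\in\{0,1\}^{k\times n}$ and $D=\operatorname{diag}(\lambda_i)_{1\le i\le n}$ the canonical factors of $L$ (defined in the context), so that $C$ is a lumping of both $\underline{M}=D\underline{A}D^{-1}$ and $\overline{M}=D\overline{A}D^{-1}$, and let $\underline{R}=L\underline{A}L^+$. For any admissible $R(\cdot)\in[L\underline{A}L^+;L\overline{A}L^+]$ define $A(\cdot)=(A_{i,j}(\cdot))_{i,j}$ as follows. If $[i],[j]\ne0$, set $$A_{i,j}(t)=\lambda_i^{-1}\lambda_j\left(\underline{M}_{i,j}+\frac{(\overline{M}_{i,j}-\underline{M}_{i,j})\,(R_{[i],[j]}(t)-\underline{R}_{[i],[j]})}{\sum_{p\in H_{[i]}}(\overline{M}_{p,j}-\underline{M}_{p,j})}\right)$$ provided the division is well-defined (the denominator is non-zero); in all other cases set $A_{i,j}(t)=\lambda_i^{-1}\lambda_j\underline{M}_{i,j}$. Then $A(\cdot)\in[\underline{A};\overline{A}]$, $L$ is a lumping for $A(\cdot)$ and $R(\cdot)=LA(\cdot)L^+$; hence $Lx^{(A,u)}=y^{(R,u)}$ for every $x[0]\in\mathbb{R}_{\ge0}^n$ and every admissible $u(\cdot)\in U$.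
   Context: Notation. $\operatorname{rs}(L)$ is the row space of a matrix $L$. For $L\in\mathbb{R}^{k\times n}$ of rank $k\le n$, $L^+=L^T(LL^T)^{-1}$. The order $\le$ on matrices is component-wise, and $[\underline{A};\overline{A}]$ is the set of matrices $M$ with $\underline{A}\le M\le\overline{A}$. A function $A(\cdot)$ of time $t\ge 0$ is admissible if it is piecewise continuous with right limits and takes values in the prescribed set ($A(\cdot)\in[\underline{A};\overline{A}]$); similarly for $u(\cdot)\in U$ and $R(\cdot)\in[L\underline{A}L^+;L\overline{A}L^+]$. A matrix is Metzler if its off-diagonal entries are non-negative. PCS. A positive controlled system (PCS) $([\underline{A};\overline{A}],O,B,U)$ is given by $\partial_t x(t)=A(t)x(t)+Bu(t)$, $z(t)=Ox(t)$, where $O\in\mathbb{R}^{l\times n}$, $B\in\mathbb{R}_{\ge0}^{n\times m}$, $\underline{A},\overline{A}\in\mathbb{R}^{n\times n}$ are Metzler with $\underline{A}\le\overline{A}$, $U\subseteq\mathbb{R}_{\ge0}^m$ is compact and contains the origin, and $A(\cdot)\in[\underline{A};\overline{A}]$, $u(\cdot)\in U$ are admissible. The solution with initial condition $x[0]\in\mathbb{R}_{\ge0}^n$ is denoted $x^{(A,u)}$. Lumpings. $L\in\mathbb{R}^{k\times n}$ of rank $k\le n$ is a (constrained) lumping of $A\in\mathbb{R}^{n\times n}$ with respect to $O$ if $\operatorname{rs}(O)\subseteq\operatorname{rs}(L)$ and $\operatorname{rs}(LA)\subseteq\operatorname{rs}(L)$; it is a lumping for a matrix function $A(\cdot)$ if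 it is one for $A(t)$ at every $t$. (The output matrix is $O$ for $\underline A,\overline A,A(\cdot)$ and $OD^{-1}$ for $\underline M,\overline M$.) $L\in\mathbb{R}_{\ge0}^{k\times n}$ is proper if it has rank $k\le n$ and its rows have pairwise disjoint supports. $L$ is a constrained proper positive lumping of the PCS if $L\in\mathbb{R}_{\ge0}^{k\times n}$ is proper and is a constrained lumping of both $\underline{A}$ and $\overline{A}$ with respect to $O$. Reduced PCS. It is $([L\underline{A}L^+;L\overline{A}L^+],OL^+,LB,U)$ with initial condition $y[0]=Lx[0]$; $y^{(R,u)}$ is the solution of $\partial_t y=R(t)y+LBu(t)$, $y(0)=Lx[0]$. Blocks. For a proper $L$ and $1\le r\le k$, $H_r$ is the support of the $r$-th row of $L$, and $H_0=\{i\mid\text{the }i\text{-th column of }L\text{ is zero}\}$. For $1\le i\le n$, $[i]\in\{0,1,\dots,k\}$ is the unique index with $i\in H_{[i]}$. Canonical factors. For a proper $L$, $C\in\{0,1\}^{k\times n}$ is given by $C_{r,i}=1$ if $L_{r,i}>0$ and $C_{r,i}=0$ otherwise, and $D=\operatorname{diag}(\lambda_i)_{1\le i\le n}$ where $\lambda_i$ is the unique positive entry of the $i$-th column of $L$ if $i\notin H_0$, and $\lambda_i=1$ if $i\in H_0$. Then $L=CD$. *)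

(* Defs.v *)
(* MathComp / MathComp-Analysis, over an arbitrary R : realType.

   Conventions: functions of time are total functions on R of which only the
   restriction to t >= 0 matters; a state is a column vector 'cV[R]_n; an index
   in {0, 1, ..., k} is an option 'I_k, with None standing for 0. *)
From HB Require Import structures.
From mathcomp Require Import all_boot all_order all_algebra.
From mathcomp Require Import all_classical all_reals all_analysis.

Set Implicit Arguments.
Unset Strict Implicit.
Unset Printing Implicit Defensive.

Import Order.TTheory GRing.Theory Num.Theory.
Import numFieldNormedType.Exports.

Local Open Scope ring_scope.

Section Lumping.
Variable R : realType.

Definition mx_le m n (A B : 'M[R]_(m, n)) : Prop := forall i j, A i j <= B i j.

Definition mx_nonneg m n (A : 'M[R]_(m, n)) : Prop := forall i j, 0 <= A i j.

Definition Metzler n (A : 'M[R]_n) : Prop := forall i j, i != j -> 0 <= A i j.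

Definition rpinv k n (L : 'M[R]_(k, n)) : 'M[R]_(n, k) :=
  L^T *m invmx (L *m L^T).

(* (X <= Y)%MS is the inclusion of the row space of X in that of Y. *)
Definition lumping l k n (O : 'M[R]_(l, n)) (L : 'M[R]_(k, n)) (A : 'M[R]_n)
    : Prop :=
  [/\ \rank L = k, (O <= L)%MS & (L *m A <= L)%MS].

Definition row_supp k n (L : 'M[R]_(k, n)) (r : 'I_k) : {set 'I_n} :=
  [set i | L r i != 0].

Definition proper_mx k n (L : 'M[R]_(k, n)) : Prop :=
  [/\ mx_nonneg L, \rank L = k &
      forall r s, r != s -> [disjoint row_supp L r & row_supp L s]].

Definition block k n (L : 'M[R]_(k, n)) (q : option 'I_k) : {set 'I_n} :=
  if q is Some r then row_supp L r else [set i | col i L == 0].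

(* For proper L the q below exists and is unique; the default is not used. *)
Definition block_of k n (L : 'M[R]_(k, n)) (i : 'I_n) : option 'I_k :=
  odflt None [pick q | i \in block L q].

Definition col_weight k n (L : 'M[R]_(k, n)) (i : 'I_n) : R :=
  if [pick r | 0 < L r i] is Some r then L r i else 1.

Definition factorC k n (L : 'M[R]_(k, n)) : 'M[R]_(k, n) :=
  \matrix_(r, i) (if 0 < L r i then 1 else 0).

Definition factorD k n (L : 'M[R]_(k, n)) : 'M[R]_n :=
  diag_mx (\row_i col_weight L i).

Definition rescale k n (L : 'M[R]_(k, n)) (A : 'M[R]_n) : 'M[R]_n :=
  factorD L *m A *m invmx (factorD L).

Definition reduce k n (L : 'M[R]_(k, n)) (A : 'M[R]_n) : 'M[R]_k :=
  L *m A *m rpinv L.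

(* The value A(t), where Rt is the value R(t). *)
Definition lift_mx k n (L : 'M[R]_(k, n)) (Alo Aup : 'M[R]_n) (Rt : 'M[R]_k)
    : 'M[R]_n :=
  let Mlo := rescale L Alo in
  let Mup := rescale L Aup in
  let Rlo := reduce L Alo in
  \matrix_(i, j)
    ((col_weight L i)^-1 * col_weight L j *
     match block_of L i, block_of L j with
     | Some r, Some s =>
         let den := \sum_(p in block L (Some r)) (Mup p j - Mlo p j) in
         if den != 0 then
           Mlo i j + (Mup i j - Mlo i j) * (Rt r s - Rlo r s) / den
         else Mlo i j
     | _, _ => Mlo i j
     end).

Local Open Scope classical_set_scope.

Definition mx_interval m n (Alo Aup : 'M[R]_(m, n)) : set 'M[R]_(m, n) :=
  [set A | mx_le Alo A /\ mx_le A Aup].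

Record PCS n m l (Alo Aup : 'M[R]_n) (O : 'M[R]_(l, n)) (B : 'M[R]_(n, m))
    (U : set 'cV[R]_m) : Prop := {
  PCS_Alo : Metzler Alo;
  PCS_Aup : Metzler Aup;
  PCS_le : mx_le Alo Aup;
  PCS_B : mx_nonneg B;
  PCS_U : forall v, U v -> mx_nonneg v;
  PCS_compact : compact U;
  PCS_origin : U 0 }.

Definition proper_positive_lumping l k n (Alo Aup : 'M[R]_n)
    (O : 'M[R]_(l, n)) (L : 'M[R]_(k, n)) : Prop :=
  [/\ proper_mx L, lumping O L Alo & lumping O L Aup].

(* Finitely many discontinuities in every bounded time interval, and a right
   limit at every t >= 0. *)
Definition piecewise_continuous (V : ptopologicalType) (f : R -> V) : Prop :=
  (forall T : R,
     finite_set [set t | 0 < t < T /\ ~ {for t, continuous f}]) /\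
  (forall t : R, 0 <= t -> cvg (f s @[s --> t^'+])).

Definition admissible (V : ptopologicalType) (S : set V) (f : R -> V) : Prop :=
  piecewise_continuous f /\ forall t : R, 0 <= t -> S (f t).

(* x is the state trajectory of x' = A x + B u from x0: it is continuous on
   [0, +oo) and satisfies the equation away from the jumps of A and u, where x
   need not be differentiable. *)
Definition solution n m (A : R -> 'M[R]_n) (B : 'M[R]_(n, m))
    (u : R -> 'cV[R]_m) (x0 : 'cV[R]_n) (x : R -> 'cV[R]_n) : Prop :=
  [/\ x 0 = x0,
      {within [set t | 0 <= t], continuous x} &
      forall t : R, 0 < t -> {for t, continuous A} -> {for t, continuous u} ->
        is_derive t (1 : R) x (A t *m x t + B *m u t)].

End Lumping.

(* Main.v *)
Require Import Defs.
From HB Require Import structures.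
From mathcomp Require Import all_boot all_order all_algebra.
From mathcomp Require Import all_classical all_reals all_analysis.
From mathcomp Require Import ring lra.

Set Implicit Arguments.
Unset Strict Implicit.
Unset Printing Implicit Defensive.

Import Order.TTheory GRing.Theory Num.Theory.
Import numFieldNormedType.Exports.

Local Open Scope classical_set_scope.
Local Open Scope ring_scope.

(** Write [L = C D] with [C] a 0-1 matrix and [D] diagonal, and rescale every
    matrix [A] to [M = D A D^-1]. An inclusion of row spaces
    [(L *m A <= L)%MS] is the same as an equation [L A = X L], in which [X] is
    forced to be the reduced matrix because [L] has a right inverse, and this
    equation is equivalent to [C M = X C]. Entrywise the latter says that the sum of [M p j] over the
    rows [p] of block [r] is [X r s] if [j] lies in block [s], and [0] if
    column [j] of [L] vanishes ([block_sum_rescale]).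

    Consequently the denominator in the definition of the lift is the length of
    the interval in which [R_rs(t)] is prescribed, and the rescaled lift
    interpolates between the two rescaled bounds with a ratio in [0, 1] that is
    constant on each pair of blocks ([rescale_lift]). So the lift lies between
    the bounds ([lift_interval]). Summing over a block, the ratio factors out
    and the sum is exactly [R_rs(t)]; when the interval degenerates to a point
    there is nothing to interpolate. Hence [L A(t) = R(t) L] ([mulmx_lift]),
    which contains both lumpability and [R(t) = L A(t) L^+]. The lift is an
    affine function of [R(t)], so it inherits piecewise continuity.

    For the trajectories, [w = L x - y] is continuous, vanishes at [0], and
    satisfies [w' = R(t) w] except at finitely many times in every bounded
    interval. As [R(t)] is bounded, the function [exp (- K t) |w|^2] is
    nonincreasing for large [K] ([linear_ode_unique]), so [w = 0]. *)

(** * Row spaces and the reduced matrix *)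

(** Over an ordered field, [v L L^T = 0] gives [(v L) (v L)^T = 0], a sum of
    squares, so [v L = 0]. This is what makes [rpinv L] a right inverse. *)
Lemma mulmx_tr_unitmx (R : realFieldType) k n (L : 'M[R]_(k, n)) :
  \rank L = k -> L *m L^T \in unitmx.
Proof.
move=> rkL; rewrite -row_free_unit; apply: inj_row_free => v /= vLL0.
have vL0 : v *m L = 0.
  have sq0 : \sum_j (v *m L) 0 j ^+ 2 = 0.
    transitivity ((v *m L *m (v *m L)^T) 0 0).
      by rewrite [RHS]mxE; apply: eq_bigr => j _; rewrite [_^T _ _]mxE expr2.
    by rewrite trmx_mul mulmxA -(mulmxA v) vLL0 mul0mx mxE.
  apply/rowP => j; rewrite [RHS]mxE.
  apply/eqP; rewrite -sqrf_eq0; apply/eqP.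
  by apply: (psumr_eq0P _ sq0) => // i _; exact: sqr_ge0.
have freeL : row_free L by rewrite /row_free rkL.
by apply: (row_free_inj freeL); rewrite vL0 mul0mx.
Qed.

Lemma mulmx_rpinv (R : realType) k n (L : 'M[R]_(k, n)) :
  \rank L = k -> L *m rpinv L = 1%:M.
Proof. by move=> rkL; rewrite /rpinv mulmxA mulmxV // mulmx_tr_unitmx. Qed.

(** An inclusion of row spaces provides some [X] with [L A = X L]; multiplying
    by the right inverse of [L] identifies [X] as the reduced matrix. *)
Lemma mulmx_reduce (R : realType) k n (L : 'M[R]_(k, n)) (A : 'M[R]_n) :
  \rank L = k -> (L *m A <= L)%MS -> L *m A = reduce L A *m L.
Proof.
move=> rkL /submxP [X LA]; rewrite /reduce LA -(mulmxA X) mulmx_rpinv //.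
by rewrite mulmx1.
Qed.

Lemma reduce_unique (R : realType) k n (L : 'M[R]_(k, n)) (A : 'M[R]_n)
    (X : 'M[R]_k) :
  \rank L = k -> L *m A = X *m L -> X = reduce L A.
Proof. by move=> rkL LA; rewrite /reduce LA -mulmxA mulmx_rpinv // mulmx1. Qed.

(** * Blocks and canonical factors *)

(** The supports of the rows being disjoint, a column has at most one nonzero
    entry: the block index says where it is, the column weight what it is. *)
Lemma proper_entry (R : realType) k n (L : 'M[R]_(k, n)) r i : proper_mx L ->
  L r i = if block_of L i == Some r then col_weight L i else 0.
Proof.
move=> [L0 _ disj].
have uniq_row s q : L s i != 0 -> L q i != 0 -> s = q.
  move=> Ls Lq; apply: contraTeq isT => sq.
  have /pred0P/(_ i) := disj _ _ sq.
  by rewrite /= !inE Ls Lq.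
rewrite /block_of; case: pickP => [[q|]|noblock] /=.
- rewrite inE => Lq.
  have Lq_gt0 : 0 < L q i by rewrite lt_def Lq L0.
  rewrite /col_weight; case: pickP => [s /lt0r_neq0 Ls|/(_ q)]; last first.
    by rewrite Lq_gt0.
  rewrite (uniq_row _ _ Ls Lq).
  case: eqP => [[->]//|/eqP qr]; apply: contraNeq qr => Lr.
  by rewrite (uniq_row _ _ Lq Lr).
- by rewrite inE => /eqP/colP/(_ r); rewrite !mxE.
- by have := noblock (Some r); rewrite inE => /eqP.
Qed.

Lemma col_weight_gt0 (R : realType) k n (L : 'M[R]_(k, n)) i :
  0 < col_weight L i.
Proof. by rewrite /col_weight; case: pickP => [r ->//|_]; rewrite ltr01. Qed.

Lemma mem_block (R : realType) k n (L : 'M[R]_(k, n)) r i : proper_mx L ->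
  (i \in block L (Some r)) = (block_of L i == Some r).
Proof.
move=> pL; rewrite inE proper_entry //; case: ifP => _; last by rewrite eqxx.
by rewrite gt_eqF // col_weight_gt0.
Qed.

Lemma factorC_entry (R : realType) k n (L : 'M[R]_(k, n)) r i : proper_mx L ->
  factorC L r i = (block_of L i == Some r)%:R.
Proof.
move=> pL; rewrite mxE proper_entry //; case: eqP => _; last by rewrite ltxx.
by rewrite col_weight_gt0.
Qed.

Lemma factor_decomp (R : realType) k n (L : 'M[R]_(k, n)) :
  proper_mx L -> L = factorC L *m factorD L.
Proof.
move=> pL; apply/matrixP => r i.
rewrite mul_mx_diag mxE factorC_entry // mxE proper_entry //.
by case: eqP; rewrite ?mul1r ?mul0r.
Qed.

Lemma factorD_mulV (R : realType) k n (L : 'M[R]_(k, n)) :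
  factorD L *m diag_mx (\row_i (col_weight L i)^-1) = 1%:M.
Proof.
rewrite mulmx_diag -diag_const_mx; congr diag_mx; apply/rowP => i.
by rewrite !mxE mulfV // gt_eqF // col_weight_gt0.
Qed.

Lemma factorD_unit (R : realType) k n (L : 'M[R]_(k, n)) :
  factorD L \in unitmx.
Proof. by have [] := mulmx1_unit (factorD_mulV L). Qed.

Lemma rescale_entry (R : realType) k n (L : 'M[R]_(k, n)) (A : 'M[R]_n) i j :
  rescale L A i j = col_weight L i * A i j / col_weight L j.
Proof.
have invD : invmx (factorD L) = diag_mx (\row_i (col_weight L i)^-1).
  by rewrite -[LHS]mulmx1 -(factorD_mulV L) mulKmx ?factorD_unit.
rewrite /rescale invD mul_mx_diag mxE mul_diag_mx !mxE.
by [].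
Qed.

(** [C M = L A D^-1] and [X C = X L D^-1], so the intertwining equations for
    [(C, M)] and [(L, A)] differ by the invertible factor [D^-1]: the lumped
    matrix is the same before and after rescaling. *)
Lemma factorC_rescale (R : realType) k n (L : 'M[R]_(k, n)) (A : 'M[R]_n) X :
  proper_mx L ->
  (factorC L *m rescale L A == X *m factorC L) = (L *m A == X *m L).
Proof.
move=> pL; have uD := factorD_unit L.
rewrite /rescale !mulmxA -(factor_decomp pL).
apply/eqP/eqP => [E|E].
  by rewrite {2}(factor_decomp pL) mulmxA -E mulmxKV.
by rewrite E {1}(factor_decomp pL) mulmxA mulmxK.
Qed.

Lemma factorC_lumping (R : realType) l k n (O : 'M[R]_(l, n))
    (L : 'M[R]_(k, n)) (A : 'M[R]_n) :
  proper_mx L -> lumping O L A ->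
  lumping (O *m invmx (factorD L)) (factorC L) (rescale L A).
Proof.
move=> pL [rkL OL LA]; have uD := factorD_unit L.
have CE : factorC L = L *m invmx (factorD L).
  by rewrite {2}(factor_decomp pL) mulmxK.
split.
- rewrite -[RHS]rkL [in RHS](factor_decomp pL) mxrankMfree //.
  by rewrite row_free_unit.
- by rewrite CE submxMr.
- have /eqP : L *m A = reduce L A *m L by exact: mulmx_reduce.
  by rewrite -factorC_rescale // => /eqP ->; exact: submxMl.
Qed.

Lemma factorC_mulE (R : realType) k n (L : 'M[R]_(k, n)) (M : 'M[R]_n) r j :
  proper_mx L ->
  (factorC L *m M) r j = \sum_(p in block L (Some r)) M p j.
Proof.
move=> pL; rewrite mxE [RHS]big_mkcond; apply: eq_bigr => p _.
by rewrite factorC_entry // mem_block //; case: eqP; rewrite ?mul1r ?mul0r.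
Qed.

Lemma mul_factorCE (R : realType) k n (L : 'M[R]_(k, n)) (X : 'M[R]_k) r j :
  proper_mx L ->
  (X *m factorC L) r j = if block_of L j is Some s then X r s else 0.
Proof.
move=> pL; rewrite mxE; case Ej: (block_of L j) => [s|]; last first.
  by rewrite big1 // => s _; rewrite factorC_entry // Ej mulr0.
rewrite (bigD1 s) //= factorC_entry // Ej eqxx mulr1 big1 ?addr0 // => q qs.
by rewrite factorC_entry // Ej eqE /= eq_sym (negPf qs) mulr0.
Qed.

(** The entrywise form of [C M = (reduce L A) C]: since [C] is a 0-1 matrix,
    the left side sums [M] over a block of rows, and the right side depends on
    the column [j] only through its block. This evaluates the denominator in
    the definition of [lift_mx] as a difference of reduced entries. *)
Lemma block_sum_rescale (R : realType) l k n (O : 'M[R]_(l, n))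
    (L : 'M[R]_(k, n)) (A : 'M[R]_n) r j :
  proper_mx L -> lumping O L A ->
  \sum_(p in block L (Some r)) rescale L A p j =
  if block_of L j is Some s then reduce L A r s else 0.
Proof.
move=> pL [rkL _ LA]; rewrite -factorC_mulE // -mul_factorCE //.
have /eqP : L *m A = reduce L A *m L by exact: mulmx_reduce.
by rewrite -factorC_rescale // => /eqP ->.
Qed.

Lemma rescale_le (R : realType) k n (L : 'M[R]_(k, n)) (A A' : 'M[R]_n) i j :
  (rescale L A i j <= rescale L A' i j) = (A i j <= A' i j).
Proof.
rewrite !rescale_entry ler_pM2r ?invr_gt0 ?col_weight_gt0 //.
by rewrite ler_pM2l ?col_weight_gt0.
Qed.

(** * The lifted matrix *)

Section Lift.
Variables (R : realType) (l k n : nat) (Alo Aup : 'M[R]_n).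
Variables (O : 'M[R]_(l, n)) (L : 'M[R]_(k, n)).
Hypothesis hL : proper_positive_lumping Alo Aup O L.

Let pL : proper_mx L. Proof. by case: hL. Qed.
Let lump_lo : lumping O L Alo. Proof. by case: hL. Qed.
Let lump_up : lumping O L Aup. Proof. by case: hL. Qed.

(** The position of [Rt r s] in the interval between the reduced bounds. When
    that interval is a single point, division by zero yields [0], which agrees
    with the default case of [lift_mx]. *)
Definition interp_ratio (Rt : 'M[R]_k) (i j : 'I_n) : R :=
  if (block_of L i, block_of L j) is (Some r, Some s) then
    (Rt r s - reduce L Alo r s) / (reduce L Aup r s - reduce L Alo r s)
  else 0.

(** After rescaling, each entry of the lift is the interpolation of the bounds
    by a ratio that only depends on the blocks of [i] and [j]; this blockwise
    constancy is what preserves lumpability. *)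
Lemma rescale_lift Rt i j :
  rescale L (lift_mx L Alo Aup Rt) i j =
  rescale L Alo i j
  + (rescale L Aup i j - rescale L Alo i j) * interp_ratio Rt i j.
Proof.
rewrite rescale_entry mxE /interp_ratio.
set V := match block_of L i with Some _ => _ | None => _ end.
have w_neq0 q : col_weight L q != 0 by rewrite gt_eqF // col_weight_gt0.
have -> : col_weight L i * ((col_weight L i)^-1 * col_weight L j * V)
    / col_weight L j = V.
  by rewrite -!mulrA mulrA mulfV // mul1r mulrCA mulrA -mulrA mulfV // mulr1.
rewrite {}/V.
case: (block_of L i) => [r|]; last by rewrite mulr0 addr0.
case Ej: (block_of L j) => [s|]; last by rewrite mulr0 addr0.
rewrite sumrB !(@block_sum_rescale _ _ _ _ O) // Ej.
case: ifPn => [_|/negPn/eqP ->]; first by rewrite mulrA.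
by rewrite invr0 !mulr0 addr0.
Qed.

Lemma lift_interval Rt : mx_le Alo Aup ->
  mx_interval (reduce L Alo) (reduce L Aup) Rt ->
  mx_interval Alo Aup (lift_mx L Alo Aup Rt).
Proof.
move=> leA [loR upR].
have frac01 i j : 0 <= interp_ratio Rt i j <= 1.
  rewrite /interp_ratio.
  case: (block_of L i) => [r|]; last by rewrite lexx ler01.
  case: (block_of L j) => [s|]; last by rewrite lexx ler01.
  have num_ge0 : 0 <= Rt r s - reduce L Alo r s by rewrite subr_ge0.
  have num_le : Rt r s - reduce L Alo r s <=
      reduce L Aup r s - reduce L Alo r s by rewrite lerD2r.
  have den_ge0 := le_trans num_ge0 num_le.
  rewrite divr_ge0 //=; move: den_ge0; rewrite le_eqVlt => /orP[/eqP<-|den_gt0].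
    by rewrite invr0 mulr0 ler01.
  by rewrite ler_pdivrMr // mul1r.
split=> i j; rewrite -(rescale_le L) rescale_lift;
  have /andP[f0 f1] := frac01 i j.
  by rewrite lerDl mulr_ge0 // subr_ge0 rescale_le.
by rewrite addrC -lerBrDr ler_piMr // subr_ge0 rescale_le.
Qed.

(** Summing the interpolation over the rows of a block pulls the common ratio
    out, and the block sums of the bounds are the reduced bounds, so the sum is
    the prescribed entry [Rt r s]. *)
Lemma mulmx_lift Rt :
  mx_interval (reduce L Alo) (reduce L Aup) Rt ->
  L *m lift_mx L Alo Aup Rt = Rt *m L.
Proof.
move=> [loR upR]; apply/eqP; rewrite -factorC_rescale //; apply/eqP/matrixP => r j.
rewrite factorC_mulE // mul_factorCE //.
under eq_bigr do rewrite rescale_lift.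
rewrite big_split /= (@block_sum_rescale _ _ _ _ O) //.
case Ej: (block_of L j) => [s|]; last first.
  rewrite big1 ?addr0 // => p _; rewrite /interp_ratio Ej.
  by case: (block_of L p) => [?|]; rewrite mulr0.
set d := reduce L Aup r s - reduce L Alo r s.
under eq_bigr => p.
  rewrite mem_block // => /eqP Ep; rewrite /interp_ratio Ep Ej -/d.
  over.
rewrite -mulr_suml sumrB !(@block_sum_rescale _ _ _ _ O) // Ej -/d.
(* If d = 0, the interval has one point and no interpolation is required. *)
have [d0|d_neq0] := eqVneq d 0; last by rewrite mulrCA mulfV // mulr1 addrC subrK.
have RE : reduce L Alo r s = reduce L Aup r s.
  by apply/esym/eqP; rewrite -subr_eq0 -/d d0.
rewrite d0 mul0r addr0; apply/eqP; rewrite eq_le loR RE upR //.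
Qed.

Lemma lift_lumping Rt :
  mx_interval (reduce L Alo) (reduce L Aup) Rt ->
  lumping O L (lift_mx L Alo Aup Rt).
Proof.
by move=> RI; case: lump_lo => rkL OL _; split => //; rewrite mulmx_lift // submxMl.
Qed.

Lemma reduce_lift Rt :
  mx_interval (reduce L Alo) (reduce L Aup) Rt ->
  Rt = reduce L (lift_mx L Alo Aup Rt).
Proof.
by move=> RI; case: lump_lo => rkL _ _; apply: reduce_unique => //; exact: mulmx_lift.
Qed.

End Lift.
(** * Matrix-valued functions: limits, derivatives, continuity *)

Lemma cvg_mx_coord (R : realFieldType) (T : Type) (F : set_system T) m n
    (f : T -> 'M[R]_(m, n)) (M : 'M[R]_(m, n)) : Filter F ->
  (forall i j, f x i j @[x --> F] --> M i j) -> f @ F --> M.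
Proof.
move=> FF fM; apply/cvgrPdist_le => /= e e0.
near=> x.
rewrite /Num.Def.normr /= mx_normrE (bigmax_le _ (ltW e0)) //= => i _.
rewrite !mxE; move: i; near: x; apply: filter_forall => /= i.
exact: ((cvgrPdist_le _ _).1 (fM i.1 i.2)).
Unshelve. all: by end_near. Qed.

Lemma is_derive_coord (R : realFieldType) (V : normedModType R) m n
    (M : V -> 'M[R]_(m, n)) t v dM i j :
  is_derive t v M dM -> is_derive t v (fun x => M x i j) (dM i j).
Proof.
move=> [dM_ex dME]; split; first exact: ((derivable_mxP M t v).1 dM_ex).
by move: dME; rewrite derive_mx // => <-; rewrite mxE.
Qed.

Lemma is_derive_mulmx (R : realFieldType) (V : normedModType R) k n p
    (A : 'M[R]_(k, n)) (M : V -> 'M[R]_(n, p)) t v dM i j :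
  is_derive t v M dM -> is_derive t v (fun x => (A *m M x) i j) ((A *m dM) i j).
Proof.
move=> dMt.
have -> : (fun x => (A *m M x) i j) = \sum_q (A i q \*: (fun x => M x q j)).
  by apply/funext => x; rewrite fct_sumE mxE.
have -> : (A *m dM) i j = \sum_q A i q *: dM q j by rewrite mxE.
by apply: is_derive_sum => q; apply: is_deriveZ; exact: is_derive_coord.
Qed.

Lemma mulmx_continuous (R : realFieldType) k n p (A : 'M[R]_(k, n)) :
  continuous (fun M : 'M[R]_(n, p) => A *m M).
Proof.
move=> M; apply: (@cvg_mx_coord _ _ (nbhs M) _ _ _ _ _) => i j; rewrite mxE.
have -> : (fun N : 'M[R]_(n, p) => (A *m N) i j) =
    (fun N => \sum_q A i q * N q j).
  by apply/funext => N; rewrite mxE.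
apply: (@cvg_big R 'I_n +%R 0 xpredT add_continuous).
by move=> q _; apply: cvgMr; exact: coord_continuous.
Qed.

(** Each entry of the lift is an affine function of one entry of its argument. *)
Lemma lift_mx_continuous (R : realType) k n (L : 'M[R]_(k, n))
    (Alo Aup : 'M[R]_n) : continuous (lift_mx L Alo Aup).
Proof.
move=> X; apply: (@cvg_mx_coord _ _ (nbhs X) _ _ _ _ _) => i j; rewrite mxE.
under eq_fun do rewrite mxE.
apply: cvgMr.
case: (block_of L i) => [r|]; last exact: cvg_cst.
case: (block_of L j) => [s|]; last exact: cvg_cst.
cbv zeta; case: ifP => _; last exact: cvg_cst.
apply: cvgD; first exact: cvg_cst.
apply: cvgMl; apply: cvgMr; apply: cvgB; last exact: cvg_cst.
exact: coord_continuous.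
Qed.

(** * Uniqueness for linear equations with jumps *)

(** Continuity glues the monotone pieces: an exceptional point inside the
    interval splits it in two, with one exceptional point fewer on each side. *)
Lemma nonincreasing_off_finite (R : realType) (s : seq R) (f : R -> R) (a b : R) :
  a <= b -> {within `[a, b], continuous f} ->
  (forall t : R, a < t < b -> t \notin s ->
    exists2 d, is_derive t 1 f d & d <= 0) ->
  f b <= f a.
Proof.
elim: s a b => [|c s IH] a b ab fab df.
  apply: (@ler0_derive1_le_cc _ f a b) => //; rewrite ?in_itv /= ?lexx ?ab //.
    by move=> t; rewrite in_itv /= => /df /(_ isT) [d [dft _] _].
  move=> t; rewrite in_itv /= => /df /(_ isT) [d dfd d0].
  by rewrite derive1E derive_val.
have sub a' b' : a <= a' -> b' <= b -> {within `[a', b'], continuous f}.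
  move=> aa' b'b; apply: continuous_subspaceW fab => t /=.
  by rewrite !in_itv /= => /andP[? ?]; rewrite (le_trans aa') ?(le_trans _ b'b).
have [/andP[ac cb]|acb] := boolP (a < c < b).
  apply: (@le_trans _ _ (f c)); apply: IH; rewrite ?ltW //.
  - by apply: sub => //; exact: ltW.
  - move=> t /andP[ct tb] ts; apply: df; first by rewrite tb (lt_trans ac).
    by rewrite inE negb_or ts (gt_eqF ct).
  - by apply: sub => //; exact: ltW.
  - move=> t /andP[at_ tc] ts; apply: df; first by rewrite at_ (lt_trans tc).
    by rewrite inE negb_or ts (lt_eqF tc).
apply: IH => // t atb ts; apply: df => //; rewrite inE negb_or ts andbT.
by apply: contraNneq acb => <-.
Qed.

(** By the inequality [2 |a b| <= a ^ 2 + b ^ 2] applied to each of the [k ^ 2]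
    terms. *)
Lemma quadratic_form_le (R : realType) k (X : 'M[R]_k) (v : 'cV[R]_k) (c : R) :
  (forall i j, `|X i j| <= c) ->
  \sum_i v i 0 * (X *m v) i 0 <= k%:R * c * \sum_i v i 0 ^+ 2.
Proof.
move=> Xc.
have termP i j : v i 0 * (X i j * v j 0) <= c * (v i 0 ^+ 2 + v j 0 ^+ 2) / 2.
  have c0 : 0 <= c by exact: le_trans (normr_ge0 _) (Xc i j).
  apply: (le_trans (ler_norm _)); rewrite !normrM mulrCA.
  apply: le_trans (_ : c * (`|v i 0| * `|v j 0|) <= _).
    by apply: ler_wpM2r; [exact: mulr_ge0 | exact: Xc].
  rewrite -mulrA ler_wpM2l // ler_pdivlMr // -(real_normK (num_real (v i 0))).
  rewrite -(real_normK (num_real (v j 0))) -subr_ge0.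
  have -> : `|v i 0| ^+ 2 + `|v j 0| ^+ 2 - `|v i 0| * `|v j 0| * 2 =
            (`|v i 0| - `|v j 0|) ^+ 2 by rewrite sqrrB mulr_natr addrAC.
  exact: sqr_ge0.
apply: le_trans (_ : \sum_i \sum_j c * (v i 0 ^+ 2 + v j 0 ^+ 2) / 2 <= _).
  by apply: ler_sum => i _; rewrite mxE mulr_sumr; apply: ler_sum.
set S := \sum_i v i 0 ^+ 2.
under eq_bigr do rewrite -mulr_suml -mulr_sumr big_split /= -/S sumr_const card_ord.
rewrite -mulr_suml -mulr_sumr big_split /= sumr_const card_ord sumrMnl -/S.
rewrite le_eqVlt -(mulr_natl S); apply/orP; left; apply/eqP.
by field.
Qed.

(** The energy [exp (- K t) |w t|^2], with [K] twice the bound on the quadratic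
    form of [X t], is continuous and has a nonpositive derivative off finitely
    many points. It starts at [0], hence stays there. *)
Lemma linear_ode_unique (R : realType) k (X : R -> 'M[R]_k) (w : R -> 'cV[R]_k)
    (c T : R) (s : seq R) :
  0 <= T -> w 0 = 0 -> {within `[0, T], continuous w} ->
  (forall (t : R) i j, 0 < t < T -> `|X t i j| <= c) ->
  (forall t : R, 0 < t < T -> t \notin s ->
    forall i, is_derive t 1 (fun r => w r i 0) ((X t *m w t) i 0)) ->
  w T = 0.
Proof.
move=> T0 w0 wc Xc dw.
pose K := 2 * (k%:R * c).
pose q (v : 'cV[R]_k) := \sum_i v i 0 ^+ 2.
pose g i := (fun t => w t i 0) : R -> R.
pose e := (fun t => expR (- K * t)) : R -> R.
pose E := (q \o w) * e.
have de (t : R) : is_derive t (1 : R) e (- K * e t).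
  have dlin : is_derive t (1 : R) (fun x : R => - K * x) (- K).
    have := @is_deriveZ _ _ _ id (- K) t (1 : R) (1 : R) (is_derive_id t (1 : R)).
    by rewrite /GRing.scale /= mulr1.
  by rewrite mulrC; apply: (is_derive1_comp _ dlin).
have qwE : q \o w = \sum_i g i ^+ 2.
  by apply/funext => t; rewrite fct_sumE.
have qc : continuous q.
  apply: (@continuous_big R 'I_k +%R 0 xpredT _ _ _ (fun i (v : 'cV[R]_k) =>
    v i 0 ^+ 2)).
    exact: add_continuous.
  move=> i _ x.
  exact: cvg_comp (@coord_continuous _ _ _ i 0 x) (@exprn_continuous _ 2 _).
have ET : E T <= E 0.
  apply: (@nonincreasing_off_finite _ s) => //.
    have qwc : {within `[0, T], continuous (q \o w)}.
      by apply: within_continuous_comp => // v _; exact: qc.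
    have ec : {within `[0, T], continuous e}.
      apply: continuous_subspaceT => t.
      by apply/differentiable_continuous/derivable1_diffP; case: (de t).
    by move=> t; apply: continuousM; [exact: qwc | exact: ec].
  move=> t tT ts; have dwt := dw _ tT ts.
  have dq : is_derive t (1 : R) (q \o w)
      (2 * \sum_i w t i 0 * (X t *m w t) i 0).
    rewrite qwE.
    have -> : 2 * \sum_i w t i 0 * (X t *m w t) i 0 =
        \sum_i ((2%:R * g i t ^+ 1) *: (X t *m w t) i 0).
      by rewrite mulr_sumr; apply: eq_bigr => i _; rewrite expr1 /GRing.scale /= mulrA.
    by apply: is_derive_sum => i; apply: is_deriveX; exact: dwt.
  exists ((q \o w) t *: (- K * e t)
      + e t *: (2 * \sum_i w t i 0 * (X t *m w t) i 0)).
    exact: is_deriveM.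
  set S := \sum_i _.
  have -> : (q \o w) t *: (- K * e t) + e t *: (2 * S) =
      e t * (2 * S - K * q (w t)).
    by rewrite /GRing.scale /=; ring.
  rewrite pmulr_rle0 ?expR_gt0 //.
  have := quadratic_form_le (w t) (fun i j => Xc t i j tT).
  by rewrite -/(q (w t)) -/S /K; lra.
have q0 : q (w 0) = 0.
  by rewrite w0 /q big1 // => i _; rewrite mxE expr0n.
have : q (w T) <= 0.
  have EE t : E t = q (w t) * e t by [].
  by move: ET; rewrite !EE q0 mul0r pmulr_lle0 // expR_gt0.
rewrite le_eqVlt => /orP[/eqP qT|]; last first.
  by rewrite ltNge sumr_ge0 // => i _; exact: sqr_ge0.
apply/matrixP => i j; rewrite (ord1 j) [RHS]mxE.
apply/eqP; rewrite -sqrf_eq0; apply/eqP.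
by apply: (psumr_eq0P _ qT) => // p _; exact: sqr_ge0.
Qed.
(** * Lumped trajectories *)

Lemma piecewise_continuous_comp (R : realType) (V W : ptopologicalType)
    (phi : V -> W) (f : R -> V) :
  continuous phi -> piecewise_continuous f -> piecewise_continuous (phi \o f).
Proof.
move=> phic [fin_disc rlim]; split=> [T|t t0].
  apply: sub_finite_set (fin_disc T) => t /= [tT ndisc]; split => // ft.
  by apply: ndisc; apply: continuous_comp => //; exact: phic.
have /cvg_ex[v fv] := rlim t t0.
by apply/cvg_ex; exists (phi v); apply: cvg_comp fv _; exact: phic.
Qed.

Lemma interval_bounded (R : realType) m n (Xlo Xup X : 'M[R]_(m, n)) i j :
  mx_interval Xlo Xup X -> `|X i j| <= \sum_p (`|Xlo p.1 p.2| + `|Xup p.1 p.2|).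
Proof.
move=> [/(_ i j) lo /(_ i j) up]; rewrite (bigD1 (i, j)) //=.
apply: ler_wpDr; first by apply: sumr_ge0 => p _; exact: addr_ge0.
rewrite ler_norml; have := ler_norm (Xup i j); have := ler_norm (- Xlo i j).
by rewrite normrN; have := normr_ge0 (Xup i j); have := normr_ge0 (Xlo i j); lra.
Qed.

Lemma piecewise_continuous_off_seq (R : realType) (V W : ptopologicalType) (f : R -> V)
    (g : R -> W) (T : R) :
  piecewise_continuous f -> piecewise_continuous g ->
  exists s : seq R, forall t, 0 < t < T -> t \notin s ->
    {for t, continuous f} /\ {for t, continuous g}.
Proof.
move=> [fin_f _] [fin_g _].
have /finite_seqP[s sE] : finite_set
    ([set t | 0 < t < T /\ ~ {for t, continuous f}] `|`
     [set t | 0 < t < T /\ ~ {for t, continuous g}]).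
  by rewrite finite_setU; split; [exact: fin_f | exact: fin_g].
exists s => t tT ts; split; apply: contrapT => ndisc; move/negP: ts; apply.
  by have : [set` s] t by rewrite -sE; left.
by have : [set` s] t by rewrite -sE; right.
Qed.

(** Since [L A = X L], the difference [L x - y] solves the homogeneous equation
    [w' = X w] from [0] wherever [X] and [u] are continuous; [X] is bounded, as
    it takes values in an interval, so the difference vanishes. *)
Lemma lumped_trajectory (R : realType) n m k (L : 'M[R]_(k, n))
    (A : R -> 'M[R]_n) (X : R -> 'M[R]_k) (B : 'M[R]_(n, m))
    (u : R -> 'cV[R]_m) (Xlo Xup : 'M[R]_k) (x0 : 'cV[R]_n)
    (x : R -> 'cV[R]_n) (y : R -> 'cV[R]_k) (t : R) :
  (forall r, {for r, continuous X} -> {for r, continuous A}) ->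
  (forall r, 0 <= r -> L *m A r = X r *m L) ->
  admissible (mx_interval Xlo Xup) X -> piecewise_continuous u ->
  solution A B u x0 x -> solution X (L *m B) u (L *m x0) y ->
  0 <= t -> L *m x t = y t.
Proof.
move=> XA LA [pcX XI] pcu [x_0 xc dx] [y_0 yc dy] t0.
have [s Xus] := piecewise_continuous_off_seq t pcX pcu.
apply/eqP; rewrite -subr_eq0; apply/eqP.
pose w r := L *m x r - y r.
have sub : `[0, t] `<=` [set r : R | 0 <= r].
  by move=> r /=; rewrite in_itv /= => /andP[].
apply: (@linear_ode_unique _ _ X w
  (\sum_p (`|Xlo p.1 p.2| + `|Xup p.1 p.2|)) t s) => //.
- by rewrite /w x_0 y_0 subrr.
- have Lxc : {within `[0, t], continuous (fun r => L *m x r)}.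
    apply: (@within_continuous_comp _ _ _ _ x (mulmx L)).
      by move=> v _; exact: mulmx_continuous.
    exact: continuous_subspaceW sub xc.
  have yc' := continuous_subspaceW sub yc.
  by move=> r; apply: cvgB; [exact: Lxc | exact: yc'].
- by move=> r i j /andP[r0 _]; apply/interval_bounded/XI/ltW.
- move=> r rt rs i; have [Xr ur] := Xus r rt rs; have /andP[r0 _] := rt.
  have dLx := is_derive_mulmx L i 0 (dx r r0 (XA r Xr) ur).
  have dyr := is_derive_coord i 0 (dy r r0 Xr ur).
  have -> : (fun q => w q i 0) =
      (fun q => (L *m x q) i 0) - (fun q => y q i 0).
    by apply/funext => q; rewrite /w [LHS]mxE [X in _ + X]mxE.
  apply: is_derive_eq.
  rewrite /w mulmxBr !mulmxDr !mulmxA (LA r (ltW r0)).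
  by rewrite ![in LHS]mxE ![in RHS]mxE; lra.
Qed.

Theorem proposition4 (R : realType) (n m l k : nat)
    (Alo Aup : 'M[R]_n) (O : 'M[R]_(l, n)) (B : 'M[R]_(n, m))
    (U : set 'cV[R]_m) (L : 'M[R]_(k, n))
    (hPCS : PCS Alo Aup O B U)
    (hL : proper_positive_lumping Alo Aup O L) :
  let C := factorC L in
  let D := factorD L in
  [/\ L = C *m D,
      lumping (O *m invmx D) C (rescale L Alo) &
      lumping (O *m invmx D) C (rescale L Aup)] /\
  forall Rf : R -> 'M[R]_k,
    admissible (mx_interval (reduce L Alo) (reduce L Aup)) Rf ->
    let A := fun t : R => lift_mx L Alo Aup (Rf t) in
    [/\ admissible (mx_interval Alo Aup) A,
        forall t : R, 0 <= t -> lumping O L (A t),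
        forall t : R, 0 <= t -> Rf t = reduce L (A t) &
        forall (x0 : 'cV[R]_n) (u : R -> 'cV[R]_m),
          mx_nonneg x0 -> admissible U u ->
          forall (x : R -> 'cV[R]_n) (y : R -> 'cV[R]_k),
            solution A B u x0 x ->
            solution Rf (L *m B) u (L *m x0) y ->
            forall t : R, 0 <= t -> L *m x t = y t].
Proof.
move=> C D; have [pL lumplo lumpup] := hL; split.
  by split; [exact: factor_decomp | exact: factorC_lumping..].
move=> Rf RfA A; have [pcR RI] := RfA; split.
- split; first by apply: piecewise_continuous_comp => //; exact: lift_mx_continuous.
  by move=> t t0; apply: (lift_interval hL) (RI t t0); case: hPCS.
- by move=> t t0; exact: (lift_lumping hL) (RI t t0).
- by move=> t t0; exact: (reduce_lift hL) (RI t t0).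
- move=> x0 u _ [pcu _] x y solx soly t t0.
  apply: (lumped_trajectory _ _ RfA pcu solx soly t0) => r.
    by move=> Rr; apply: continuous_comp => //; exact: lift_mx_continuous.
  by move=> r0; exact: (mulmx_lift hL) (RI r r0).
Qed.
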